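(* Let $p,q\in\mathcal{O}_{\overline{\mathbb{Q}}}\setminus\{0\}$ be non-zero algebraic integers, let $K=\mathbb{Q}(p,q)$, so that $p$ and $q$ are integral elements of $K$, and suppose that $p$ and $q$ are co-prime in $\mathcal{O}_K$. For $\mathfrak{z}\in\mathbb{Z}_2$ consider the formal series $$S_{p,q}(\mathfrak{z})=\sum_{n=0}^{\infty}\frac{q^{\#_1([\mathfrak{z}]_{2^n})}}{p^n}.$$ Then: (I) Let $\mathfrak{z}\in\mathbb{Z}_2\setminus\mathbb{N}_0$ and let $\ell$ be any (finite) prime of $\mathcal{O}_K$. Then $S_{p,q}(\mathfrak{z})$ converges in $\mathbb{C}_\ell$ if and only if $|p|_\ell=1$ and $|q|_\ell<1$. Moreover, when convergent, the sum $S_{p,q}(\mathfrak{z})$ is necessarily an element of $\mathcal{O}_{K_\ell}$. (II) Let $\mathfrak{z}\in\mathbb{N}_0$. Then $S_{p,q}(\mathfrak{z})$ converges in $\mathbb{C}$ if and only if $|p|_\infty>1$. Moreover, if convergent, the sum $S_{p,q}(\mathfrak{z})$ is an element of $K$.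
   Context: $\mathbb{N}_0$ is the set of integers $\geq 0$, regarded as a subset of the $2$-adic integers $\mathbb{Z}_2$. For $\mathfrak{z}\in\mathbb{Z}_2$ and $n\geq 0$, $[\mathfrak{z}]_{2^n}$ is the unique integer in $\{0,\ldots,2^n-1\}$ congruent to $\mathfrak{z}$ modulo $2^n$. For $m\in\mathbb{N}_0$, $\#_1(m)$ is the number of $1$s in the binary expansion of $m$ (so $\#_1(0)=0$). $\mathcal{O}_{\overline{\mathbb{Q}}}$ is the ring of algebraic integers, and $\mathcal{O}_K$ is the ring of integers of $K$. A (finite) prime $\ell$ of $\mathcal{O}_K$ is a non-zero prime ideal of $\mathcal{O}_K$, and $p,q$ are co-prime in $\mathcal{O}_K$ if no prime of $\mathcal{O}_K$ divides both of them. $|\cdot|_\ell$ is the $\ell$-adic absolute value on $K$, $K_\ell$ is the completion of $K$ with respect to it, and $\mathcal{O}_{K_\ell}$ is the ring of integers of $K_\ell$. $\mathbb{C}_\ell$ denotes the metric completion of the algebraic closure of $\mathbb{Q}_{p_0}$, where $p_0$ is the unique rational prime lying under $\ell$; it contains $K_\ell$ and carries the absolute value extending $|\cdot|_\ell$. Algebraic numbers are regarded as elements of $\mathbb{C}$, and $|\cdot|_\infty$ is the standard absolute value on $\mathbb{C}$. A series converges in a field if its sequence of partial sums converges with respect to that field's absolute value. *)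

(* Defs.v *)
From HB Require Import structures.
From mathcomp Require Import all_boot all_order all_algebra all_field.
From mathcomp Require Import complex.
From mathcomp Require Import ring_quotient.
From mathcomp Require Import all_classical all_reals all_analysis.

Set Implicit Arguments.
Unset Strict Implicit.
Unset Printing Implicit Defensive.

Import Order.TTheory GRing.Theory Num.Theory.
Import numFieldNormedType.Exports.

Local Open Scope classical_set_scope.
Local Open Scope ring_scope.

(* Z_2 as the inverse limit of the Z/2^n; [Z2res z n] is the representative in
   {0, ..., 2^n - 1} of z modulo 2^n. *)
Record Z2 := MkZ2 {
  Z2res :> nat -> nat;
  Z2res_lt : forall n, (Z2res n < 2 ^ n)%N;
  Z2res_compat : forall n, Z2res n.+1 = Z2res n %[mod 2 ^ n]
}.

Definition Z2_of_nat (m : nat) : Z2.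
Proof.
exists (fun n => m %% 2 ^ n)%N => n; first by rewrite ltn_mod expn_gt0.
by rewrite modn_mod expnS modn_dvdm // dvdn_mull.
Defined.

(* [odd (m %/ 2 ^ i)] is the i-th binary digit; the digits of index i >= m all
   vanish since m < 2 ^ m. *)
Definition popcount (m : nat) : nat := (\sum_(i < m) odd (m %/ 2 ^ i))%N.

Definition S_term (F : fieldType) (p q : F) (z : Z2) (n : nat) : F :=
  q ^+ popcount (z n) / p ^+ n.

Record absolute_value (R : realType) (F : fieldType) (abs : F -> R) : Prop := {
  abs_ge0 : forall x, 0 <= abs x;
  abs_eq0 : forall x, abs x = 0 <-> x = 0;
  absM : forall x y, abs (x * y) = abs x * abs y;
  absD : forall x y, abs (x + y) <= abs x + abs y
}.

Definition abs_cvg_to (R : realType) (F : fieldType) (abs : F -> R)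
    (u : nat -> F) (l : F) : Prop :=
  (fun n => abs (u n - l)) @ \oo --> (0 : R).

Definition abs_cauchy (R : realType) (F : fieldType) (abs : F -> R)
    (u : nat -> F) : Prop :=
  forall e : R, 0 < e -> exists N : nat, forall m n : nat,
    (N <= m)%N -> (N <= n)%N -> abs (u m - u n) < e.

Definition abs_series_sum (R : realType) (F : fieldType) (abs : F -> R)
    (u : nat -> F) (s : F) : Prop :=
  abs_cvg_to abs (series u) s.

Definition abs_series_cvg (R : realType) (F : fieldType) (abs : F -> R)
    (u : nat -> F) : Prop :=
  exists s : F, abs_series_sum abs u s.

Record valuedField (R : realType) := ValuedField {
  vfield :> fieldType;
  vabs : vfield -> R;
  vabsP : absolute_value vabs
}.
Arguments vabs {R v} _.

Definition valuation_ring (R : realType) (L : valuedField R) : set L :=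
  [set x | vabs x <= 1].
Arguments valuation_ring {R} L _.

Definition isometric (R : realType) (F : fieldType) (absF : F -> R)
    (L : valuedField R) (i : F -> L) : Prop :=
  forall x : F, vabs (i x) = absF x.

Record is_completion (R : realType) (F : fieldType) (absF : F -> R)
    (L : valuedField R) (i : {rmorphism F -> L}) : Prop := {
  completion_isometric : isometric absF i;
  completion_dense : forall (y : L) (e : R), 0 < e ->
    exists x : F, vabs (y - i x) < e;
  completion_complete : forall u : nat -> L, abs_cauchy (@vabs R L) u ->
    exists y : L, abs_cvg_to (@vabs R L) u y
}.

Definition is_algebraic_closure (F A : fieldType) (i : {rmorphism F -> A}) : Prop :=
  GRing.closed_field_axiom A /\ (forall x : A, algebraicOver i x).

Definition padic_val (p : nat) (x : rat) : int :=
  (logn p `|numq x|%N)%:Z - (logn p `|denq x|%N)%:Z.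

(* The base b in ]0, 1[ is the value of |p|; b = p^-1 is the usual choice. *)
Definition padic_abs (R : realType) (p : nat) (b : R) (x : rat) : R :=
  if x == 0 then 0 else b ^ padic_val p x.

(* C_p is determined up to isometric isomorphism by this data: the completion Q_p
   of Q, an algebraic closure of Q_p with an absolute value extending that of Q_p,
   and the completion of the latter. *)
Record Cp_data (R : realType) (p : nat) (b : R) := MkCp {
  Qp : valuedField R;
  Qp_in : {rmorphism rat -> Qp};
  Qp_completion : is_completion (@padic_abs R p b) Qp_in;
  Qpbar : valuedField R;
  Qpbar_in : {rmorphism Qp -> Qpbar};
  Qpbar_closure : is_algebraic_closure Qpbar_in;
  Qpbar_isometric : isometric (@vabs R Qp) Qpbar_in;
  Cp :> valuedField R;
  Cp_in : {rmorphism Qpbar -> Cp};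
  Cp_completion : is_completion (@vabs R Qpbar) Cp_in
}.

Definition integral_pred (K : fieldType) : {pred K} :=
  fun x => `[< integralOver (intr : int -> K) x >].
Arguments integral_pred K _ : clear implicits.

Lemma integral_predP (K : fieldType) (x : K) :
  reflect (integralOver (intr : int -> K) x) (x \in integral_pred K).
Proof. exact: asboolP. Qed.

Lemma integral_pred_subring (K : fieldType) : subring_closed (integral_pred K).
Proof.
split; first exact/integral_predP/integral1.
  by move=> x y /integral_predP hx /integral_predP hy; exact/integral_predP/integral_sub.
by move=> x y /integral_predP hx /integral_predP hy; exact/integral_predP/integral_mul.
Qed.

HB.instance Definition _ (K : fieldType) :=
  GRing.isSubringClosed.Build K (integral_pred K) (@integral_pred_subring K).

Record ringOfIntegers (K : fieldType) := MkOK {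
  OKval : K;
  OKvalP : OKval \in integral_pred K
}.

HB.instance Definition _ (K : fieldType) := [isSub for @OKval K].
HB.instance Definition _ (K : fieldType) := [Choice of ringOfIntegers K by <:].
HB.instance Definition _ (K : fieldType) :=
  [SubChoice_isSubComNzRing of ringOfIntegers K by <:].

(* A prime of O_K: a prime ideal, in the sense of [ring_quotient], that is not 0. *)
Record primeOf (K : fieldType) := MkPrime {
  primeIdeal :> prime_idealr (ringOfIntegers K);
  prime_neq0 : exists2 a : ringOfIntegers K, a \in primeIdeal & a != 0
}.

(* l divides a when the ideal l contains the ideal (a). *)
Definition prime_dvd (K : fieldType) (l : primeOf K) (a : ringOfIntegers K) : Prop :=
  a \in (l : prime_idealr _).

Definition coprime_OK (K : fieldType) (a b : ringOfIntegers K) : Prop :=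
  ~ exists l : primeOf K, prime_dvd l a /\ prime_dvd l b.

Definition ideal_mul (K : fieldType) (I J : set K) : set K :=
  [set x | exists s : seq (K * K),
     (forall u, u \in s -> I u.1 /\ J u.2) /\ x = \sum_(u <- s) u.1 * u.2].

(* The fractional ideal l^k of K; for k < 0 it is {x | x l^(-k) is contained in O_K}. *)
Definition prime_pow (K : fieldType) (l : primeOf K) (k : int) : set K :=
  let OK := [set x : K | x \in integral_pred K] in
  let lK := [set OKval a | a in prime_dvd l] in
  let pow n := iter n (ideal_mul lK) OK in
  match k with
  | Posz n => pow n
  | Negz n => [set x | forall y, pow n.+1 y -> OK (x * y)]
  end.

(* |x|_l = c ^ v_l(x) with v_l(x) = max {k | x in l^k}, and |0|_l = 0; the base
   c in ]0, 1[ fixes the normalisation. *)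
Definition prime_abs (R : realType) (K : fieldType) (l : primeOf K) (c : R) (x : K) : R :=
  inf [set c ^ k | k in [set k : int | prime_pow l k x]].

(* Main.v *)
(* If z is not a natural number, its digit counts e_n = #_1([z]_{2^n}) increase
   without bound.  Clearing denominators, a block of the series is
   sum_(m <= k < n) q^e_k / p^k = (q^e_m / p^n) * a with a integral, so its
   absolute value at a prime l with |p| = 1 is at most |q|^e_m, which gives
   convergence to an l-adic integer as soon as |q| < 1.  Conversely the terms
   must tend to 0, and since |p| <= 1 this forces |q| < 1, whence |p| = 1 by
   co-primality.  If z is a natural number, the digit counts are eventually
   constant and the series is geometric of ratio 1 / p. *)
Require Import Defs.
From HB Require Import structures.
From mathcomp Require Import all_boot all_order all_algebra all_field.
From mathcomp Require Import complex.
From mathcomp Require Import ring_quotient.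
From mathcomp Require Import all_classical all_reals all_analysis.
From mathcomp Require Import zify ring.

Set Implicit Arguments.
Unset Strict Implicit.
Unset Printing Implicit Defensive.

Import Order.TTheory GRing.Theory Num.Theory.
Import numFieldNormedType.Exports.

Local Open Scope classical_set_scope.
Local Open Scope ring_scope.
Local Open Scope complex_scope.

(** * Binary digit counts of the truncations of a 2-adic integer *)

Lemma popcount_sum {m n : nat} :
  (m < 2 ^ n)%N -> popcount m = (\sum_(i < n) odd (m %/ 2 ^ i))%N.
Proof.
move=> m_lt; rewrite /popcount.
have vanish a b : (m < 2 ^ a)%N -> (a <= b)%N ->
    (\sum_(i < b) odd (m %/ 2 ^ i) = \sum_(i < a) odd (m %/ 2 ^ i))%N.
  move=> ma /subnKC <-; rewrite big_split_ord /= [X in (_ + X)%N]big1 ?addn0 //.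
  move=> i _; rewrite divn_small //.
  by apply: leq_trans ma _; rewrite leq_exp2l // leq_addr.
have mm : (m < 2 ^ m)%N by apply: ltn_expl.
by case: (leqP m n) => [mn|/ltnW nm]; [rewrite -(vanish m n)|rewrite (vanish n m)].
Qed.

Lemma odd_divn_modn (m n i : nat) :
  (i < n)%N -> odd (m %% 2 ^ n %/ 2 ^ i) = odd (m %/ 2 ^ i).
Proof.
move=> i_lt; rewrite [in RHS](divn_eq m (2 ^ n)).
(* After division by [2 ^ i], the discarded multiple of [2 ^ n] is still even, so the parity does
   not change. *)
have -> : (2 ^ n = 2 ^ (n - i.+1) * 2 * 2 ^ i)%N.
  by rewrite -expnSr -expnD; congr (2 ^ _)%N; lia.
rewrite [in RHS]mulnA divnMDl ?expn_gt0 // oddD [in RHS]mulnA.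
by rewrite oddM andbF.
Qed.

(** Only the digit of index [n] is new, and it is 1 exactly when the residue changes. *)
Lemma popcountS (z : Z2) (n : nat) :
  popcount (z n.+1) = (popcount (z n) + (z n.+1 != z n))%N.
Proof.
have zS := Z2res_lt z n.+1; have zn := Z2res_lt z n.
have zE : z n = (z n.+1 %% 2 ^ n)%N.
  by rewrite Z2res_compat modn_small.
rewrite (popcount_sum zS) (popcount_sum zn) big_ord_recr /=; congr (_ + _)%N.
  by apply: eq_bigr => i _; rewrite zE odd_divn_modn.
have : (z n.+1 %/ 2 ^ n < 2)%N by rewrite ltn_divLR ?expn_gt0 // -expnS.
have := divn_eq (z n.+1) (2 ^ n); rewrite -zE.
case: (_ %/ _)%N => [|[|//]] -> _ /=; first by rewrite mul0n add0n eqxx.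
by rewrite mul1n -[X in _ != X]add0n eqn_add2r gtn_eqF ?expn_gt0.
Qed.

Lemma popcount_homo (z : Z2) : {homo (fun n => popcount (z n)) : m n / (m <= n)%N}.
Proof.
apply: homo_leq => [//|y x w|n]; first exact: leq_trans.
by rewrite popcountS leq_addr.
Qed.

Lemma Z2_eq (x y : Z2) : x =1 y -> x = y.
Proof.
case: x y => [x xlt xc] [y ylt yc] /= /funext xy.
by subst y; congr MkZ2; apply: Prop_irrelevance.
Qed.

Lemma Z2res_modn (z : Z2) (k n : nat) : (k <= n)%N -> z k = (z n %% 2 ^ k)%N.
Proof.
elim: n => [|n IH]; first by rewrite leqn0 => /eqP ->; rewrite modn_small ?Z2res_lt.
rewrite leq_eqVlt => /predU1P[->|kn]; first by rewrite modn_small ?Z2res_lt.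
have d : (2 ^ k %| 2 ^ n)%N by rewrite dvdn_exp2l.
by rewrite IH // -(modn_dvdm (z n.+1) d) Z2res_compat modn_dvdm.
Qed.

Lemma Z2_eventually_cst (z : Z2) (N : nat) :
  (forall n, (N <= n)%N -> z n.+1 = z n) -> range Z2_of_nat z.
Proof.
move=> zN; exists (z N) => //; apply: Z2_eq => k /=.
have zE n : (N <= n)%N -> z n = z N.
  by move=> /subnKC <-; elim: (n - N)%N => [|d <-]; rewrite ?addn0 // addnS zN ?leq_addr.
case: (leqP k N) => [/Z2res_modn ->//|/ltnW Nk].
by rewrite -(zE k Nk) modn_small ?Z2res_lt.
Qed.

(** Each change of residue raises the count by one, and residues that stop changing come from a
    natural number. *)
Lemma popcount_unbounded (z : Z2) :
  ~ range Z2_of_nat z -> forall M, exists n, (M <= popcount (z n))%N.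
Proof.
move=> zN; elim=> [|M [n Mn]]; first by exists 0%N.
have [k nk zk] : exists2 k, (n <= k)%N & z k.+1 != z k.
  apply: contra_notP zN => H; apply: (@Z2_eventually_cst z n) => k nk.
  by apply/eqP; apply: contra_notT H => ?; exists k.
exists k.+1; rewrite popcountS zk addn1 ltnS (leq_trans Mn) //.
exact: popcount_homo.
Qed.

Lemma Z2_of_nat_ge (m n : nat) : (m <= n)%N -> Z2_of_nat m n = m.
Proof.
move=> mn /=; rewrite modn_small //.
by apply: (@leq_trans (2 ^ m)); rewrite ?leq_exp2l // ltn_expl.
Qed.

(** * Limits and series for an abstract absolute value *)

Section AbsoluteValue.
Variables (R : realType) (F : fieldType) (abs : F -> R).
Hypothesis absP : absolute_value abs.
Implicit Types (x y : F) (u : nat -> F).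

Lemma av0 : abs 0 = 0.
Proof. exact/(abs_eq0 absP). Qed.

Lemma av_gt0 x : x != 0 -> 0 < abs x.
Proof.
move=> x0; rewrite lt_neqAle (abs_ge0 absP) andbT eq_sym.
by apply: contraNN x0 => /eqP /(abs_eq0 absP) ->.
Qed.

Lemma av1 : abs 1 = 1.
Proof.
have a0 : abs 1 != 0 by rewrite gt_eqF // av_gt0 // oner_eq0.
by apply: (mulfI a0); rewrite mulr1 -(absM absP) mulr1.
Qed.

Lemma avX x n : abs (x ^+ n) = abs x ^+ n.
Proof. by elim: n => [|n IH]; rewrite ?av1 // !exprS (absM absP) IH. Qed.

Lemma avV x : abs x^-1 = (abs x)^-1.
Proof.
have [->|x0] := eqVneq x 0; first by rewrite invr0 av0 invr0.
apply: (mulfI (lt0r_neq0 (av_gt0 x0))).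
by rewrite -(absM absP) !divff ?av1 // gt_eqF ?av_gt0.
Qed.

Lemma avN x : abs (- x) = abs x.
Proof.
have /eqP : abs (-1) ^+ 2 = 1 by rewrite -avX sqrrN expr1n av1.
rewrite sqrf_eq1 => /orP[/eqP E|/eqP E].
  by rewrite -mulN1r (absM absP) E mul1r.
by have := abs_ge0 absP (-1); rewrite E oppr_ge0 ler10.
Qed.

Lemma avB x y : abs (x - y) = abs (y - x).
Proof. by rewrite -avN opprB. Qed.

Lemma abs_cvg_toP u l : abs_cvg_to abs u l <->
  forall e : R, 0 < e -> exists N, forall n, (N <= n)%N -> abs (u n - l) < e.
Proof.
split=> [/cvgr0Pnorm_lt H e e0|H].
  have [N _ HN] := H e e0; exists N => n Nn.
  by have := HN n Nn; rewrite /= ger0_norm ?(abs_ge0 absP).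
apply/cvgr0Pnorm_lt => e e0; have [N HN] := H e e0; exists N => // n Nn /=.
by rewrite ger0_norm ?(abs_ge0 absP) // HN.
Qed.

Lemma abs_cvg_bound u l y (e : R) : abs_cvg_to abs u l ->
  (exists N, forall n, (N <= n)%N -> abs (u n - y) <= e) -> abs (l - y) <= e.
Proof.
move=> /abs_cvg_toP ul [N HN]; apply/ler_addgt0Pr => d /ul[M HM].
have -> : l - y = (u (maxn M N) - y) + (l - u (maxn M N)) by rewrite [RHS]addrC subrKA.
apply: le_trans (absD absP _ _) _; apply: lerD.
  by rewrite HN ?leq_maxr.
by rewrite avB ltW // HM ?leq_maxl.
Qed.

Lemma abs_cvg_unique u a b : abs_cvg_to abs u a -> abs_cvg_to abs u b -> a = b.
Proof.
move=> ua /abs_cvg_toP ub; apply/eqP; rewrite -subr_eq0; apply/eqP/(abs_eq0 absP).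
apply/eqP; rewrite eq_le (abs_ge0 absP) andbT; apply/ler_addgt0Pr => e e0.
rewrite add0r; apply: abs_cvg_bound ua _.
by have [N HN] := ub e e0; exists N => n /HN /ltW.
Qed.

Lemma abs_series_term u : abs_series_cvg abs u ->
  forall e : R, 0 < e -> exists N, forall n, (N <= n)%N -> abs (u n) < e.
Proof.
move=> [s /abs_cvg_toP us] e e0; have [N HN] := us _ (divr_gt0 e0 (ltr0n R 2)).
exists N => n Nn.
have -> : u n = (series u n.+1 - s) + (s - series u n).
  by rewrite subrKA seriesSB.
apply: le_lt_trans (absD absP _ _) _; rewrite [ltRHS]splitr ltrD //.
  by rewrite HN // (leq_trans Nn).
by rewrite avB HN.
Qed.

(** The terms of a convergent series tend to 0. This gives necessity both at a prime and at the
    complex place. *)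
Lemma abs_series_term_lbound u (a : R) (N : nat) : 0 < a ->
  (forall n, (N <= n)%N -> a <= abs (u n)) -> ~ abs_series_cvg abs u.
Proof.
move=> a0 au /abs_series_term /(_ _ a0) [M /(_ _ (leq_maxl M N))].
by rewrite ltNge au ?leq_maxr.
Qed.

(** The error after [n] terms is a constant times [x ^+ n]. The closed form of the sum is kept
    because it later shows that the sum comes from [K]. *)
Lemma geometric_series_cvg x y u (N : nat) : abs x < 1 ->
  (forall n, (N <= n)%N -> u n = y * x ^+ n) ->
  abs_series_sum abs u (series u N + y * x ^+ N / (1 - x)).
Proof.
move=> x1 uE.
have x1N : 1 - x != 0.
  by rewrite subr_eq0; apply: contraTneq x1 => <-; rewrite av1 ltxx.
have sE n : (N <= n)%N ->
    series u n - (series u N + y * x ^+ N / (1 - x)) = - (y / (1 - x)) * x ^+ n.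
  move=> /subnKC <-; elim: (n - N)%N => [|d IH]; first by rewrite addn0; field.
  by rewrite addnS seriesSr uE ?leq_addr // addrAC IH exprS; field.
apply/abs_cvg_toP => e e0.
have /cvgr0Pnorm_lt/(_ e e0)[M _ HM] :
    (fun n => abs (y / (1 - x)) * abs x ^+ n) @ \oo --> (0 : R).
  rewrite -[X in _ --> X](mulr0 (abs (y / (1 - x)))); apply: cvgMr.
  by apply: cvg_expr; rewrite ger0_norm ?(abs_ge0 absP).
exists (maxn M N) => n; rewrite geq_max => /andP[Mn Nn].
rewrite sE // (absM absP) avN avX; apply: le_lt_trans (HM n Mn).
exact: ler_norm.
Qed.

End AbsoluteValue.

Lemma normc_absolute_value (R : realType) :
  absolute_value (@ComplexField.Normc.normc R).
Proof.
split=> [[a b]|x|x y|x y]; first exact: sqrtr_ge0.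
- split=> [|->]; first exact: ComplexField.Normc.eq0_normc.
  by rewrite ComplexField.Normc.normc0.
- exact: ComplexField.Normc.normcM.
- exact: le_normcD.
Qed.

(** * The absolute value of a prime on algebraic integers *)

Section PrimeAbs.
Variables (R : realType) (K : fieldType) (l : primeOf K) (c : R).
Hypothesis c01 : 0 < c < 1.

Let c_gt0 : 0 < c. Proof. by case/andP: c01. Qed.

(** An integer lies in the zeroth power of [l], so [c ^ 0 = 1] is among the values whose infimum is
    taken. *)
Lemma prime_abs_le1 (a : ringOfIntegers K) : prime_abs l c (OKval a) <= 1.
Proof.
apply: ge_inf; first by exists 0 => _ [k _ <-]; exact/ltW/exprz_gt0.
by exists 0 => //; exact: OKvalP.
Qed.

(** Every summand of an element of a positive power has a factor in [l], which is an ideal. *)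
Lemma prime_pow_subset (n : nat) (x : K) : prime_pow l n x ->
  exists2 a : ringOfIntegers K, OKval a = x & (0 < n)%N -> prime_dvd l a.
Proof.
elim: n x => [|n IH] x /=; first by move=> hx; exists (MkOK hx).
case=> s [sP ->]; elim: s sP => [|[v w] s IHs] sP.
  by rewrite big_nil; exists 0 => // _; rewrite /prime_dvd rpred0.
have [|a aE al] := IHs; first by move=> t ts; apply: sP; rewrite inE ts orbT.
have [[v' /= v'l vE] /= /IH[w' wE _]] := sP (v, w) (mem_head _ _).
exists (v' * w' + a); first by rewrite big_cons -aE /= -vE -wE.
by move=> _; rewrite /prime_dvd rpredD ?al // mulrC idealMr.
Qed.

(** Outside [l] no positive exponent occurs, and [c ^ k >= 1] for [k <= 0] because [c < 1]. *)
Lemma prime_abs_ge1 (a : ringOfIntegers K) :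
  ~ prime_dvd l a -> 1 <= prime_abs l c (OKval a).
Proof.
move=> al; apply: lb_le_inf; first by exists 1, 0 => //; exact: OKvalP.
move=> _ [k + <-]; case: k => [[|n]|n] /=.
- by rewrite expr0z.
- by move=> /(@prime_pow_subset n.+1)[b /val_inj -> /(_ isT)].
- move=> _; rewrite NegzE -exprnN invf_ge1 ?exprn_gt0 //.
  by rewrite exprn_ile1 // ltW //; case/andP: c01.
Qed.

Lemma coprime_prime_abs (a b : ringOfIntegers K) : coprime_OK a b ->
  prime_abs l c (OKval b) < 1 -> prime_abs l c (OKval a) = 1.
Proof.
move=> ab b1; apply/eqP; rewrite eq_le prime_abs_le1 /=; apply: prime_abs_ge1 => al.
apply: ab; exists l; split=> //; apply: contrapT => /prime_abs_ge1.
by rewrite leNgt b1.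
Qed.

End PrimeAbs.

(** * The series under field embeddings, and its blocks over a common denominator *)

Lemma S_term_rmorph (F G : fieldType) (f : {rmorphism F -> G}) (p q : F) (z : Z2) :
  S_term (f p) (f q) z =1 f \o S_term p q z.
Proof. by move=> n; rewrite /S_term /= fmorph_div !rmorphXn. Qed.

Lemma series_rmorph (F G : fieldType) (f : {rmorphism F -> G}) (p q : F) (z : Z2) :
  series (S_term (f p) (f q) z) = f \o series (S_term p q z).
Proof.
apply/funext => n; rewrite /series /= rmorph_sum.
by apply: eq_bigr => i _; rewrite S_term_rmorph.
Qed.

(** In the block, every exponent of [q] is at least [popcount (z m)] by monotonicity, and every
    exponent of [p] is below [n]. *)
Lemma S_block_integral (K : fieldType) (p q : ringOfIntegers K) (z : Z2) (m n : nat) :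
  p != 0 -> (m <= n)%N -> exists a : ringOfIntegers K,
  series (S_term (OKval p) (OKval q) z) n - series (S_term (OKval p) (OKval q) z) m
    = OKval q ^+ popcount (z m) / OKval p ^+ n * OKval a.
Proof.
move=> p0; have vp0 : OKval p != 0 by apply: contraNneq p0 => H; apply/eqP/val_inj.
move=> /subnKC <-; elim: (n - m)%N => [|d [a aE]].
  by exists 0; rewrite addn0 subrr mulr0.
(* The denominator grows from [p ^+ (m + d)] to [p ^+ (m + d).+1], so the old numerator and the new
   term each gain a factor [p]. *)
rewrite addnS; exists (p * a + p * q ^+ (popcount (z (m + d)%N) - popcount (z m))).
rewrite seriesSr addrAC aE /S_term.
rewrite -{1}(@subnKC (popcount (z m)) (popcount (z (m + d)%N))).
  rewrite -[OKval (_ + _)]/(\val _) rmorphD !rmorphM rmorphXn /= exprS.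
  by rewrite [OKval q ^+ (_ + _)]exprD; field; rewrite vp0 ?expf_neq0.
by rewrite popcount_homo // leq_addr.
Qed.

(** * Convergence at a prime *)

Section PrimeConvergence.
Variables (R : realType) (K : fieldType) (l : primeOf K) (c : R).
Variables (Kl : valuedField R) (i : {rmorphism K -> Kl}).
Variables (p q : ringOfIntegers K) (z : Z2).
Hypotheses (c01 : 0 < c < 1) (iP : is_completion (prime_abs l c) i).
Hypotheses (p0 : p != 0) (zN : ~ range Z2_of_nat z).

Lemma vabs_integral_le1 (a : ringOfIntegers K) : vabs (i (OKval a)) <= 1.
Proof. by rewrite (completion_isometric iP) prime_abs_le1. Qed.

Lemma S_prime_cvg : prime_abs l c (OKval p) = 1 -> prime_abs l c (OKval q) < 1 ->
  exists2 y : Kl, valuation_ring Kl y &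
    abs_series_sum (@vabs R Kl) (S_term (i (OKval p)) (i (OKval q)) z) y.
Proof.
(* Absolute values are moved to [Kl], where [vabsP] makes them multiplicative. *)
rewrite -!(completion_isometric iP) => p1 q1.
have KlP := vabsP Kl.
have block m n : (m <= n)%N ->
    vabs (series (S_term (i (OKval p)) (i (OKval q)) z) n
          - series (S_term (i (OKval p)) (i (OKval q)) z) m)
    <= vabs (i (OKval q)) ^+ popcount (z m).
  move=> mn; rewrite series_rmorph /= -rmorphB.
  have [a ->] := S_block_integral q z p0 mn.
  rewrite rmorphM fmorph_div !rmorphXn !(absM KlP) (avV KlP) !(avX KlP) p1.
  rewrite expr1n invr1 mulr1 ler_piMr ?vabs_integral_le1 //.
  by rewrite exprn_ge0 // (abs_ge0 KlP).
have [|y sy] := completion_complete iP (u := series (S_term (i (OKval p)) (i (OKval q)) z)).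
  move=> e e0.
  have /cvgr0Pnorm_lt/(_ e e0)[M _ HM] :
      (fun n => vabs (i (OKval q)) ^+ n) @ \oo --> (0 : R).
    by apply: cvg_expr; rewrite ger0_norm ?(abs_ge0 KlP).
  (* [M] makes the powers of [|q|] small; [N] is an index at which the digit count has reached
     [M]. *)
  have [N MN] := popcount_unbounded zN M; exists N.
  have small m n : (N <= m)%N -> (m <= n)%N ->
    vabs (series (S_term (i (OKval p)) (i (OKval q)) z) n
          - series (S_term (i (OKval p)) (i (OKval q)) z) m) < e.
    move=> Nm /block /le_lt_trans; apply; apply: le_lt_trans (ler_norm _) (HM _ _).
    by rewrite /= (leq_trans MN) ?popcount_homo.
  move=> m n Nm Nn; case: (leqP m n) => [/small|/ltnW /small]; last exact.
  by rewrite (avB KlP); exact.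
exists y; last exact: sy.
(* Blocks starting at index 0 are whole partial sums, bounded by a power of [|q|], hence by 1; the
   bound passes to the limit. *)
rewrite /valuation_ring /= -[y]subr0; apply: abs_cvg_bound sy _ => //.
exists 0%N => n n0; have := block _ _ n0.
rewrite [series _ 0%N]big_geq // => /le_trans; apply.
by rewrite exprn_ile1 ?(abs_ge0 KlP) // ltW.
Qed.

(** If [|q| = 1], the terms have absolute value [|p|^(-n) >= 1] and cannot tend to 0. Co-primality
    then turns [|q| < 1] into [|p| = 1]. *)
Lemma S_prime_cvg_cond (L : valuedField R) (j : {rmorphism Kl -> L}) :
  coprime_OK p q -> isometric (@vabs R Kl) j ->
  abs_series_cvg (@vabs R L) (S_term (j (i (OKval p))) (j (i (OKval q))) z) ->
  prime_abs l c (OKval p) = 1 /\ prime_abs l c (OKval q) < 1.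
Proof.
move=> pq jP ucv; have LP := vabsP L.
suff q1 : prime_abs l c (OKval q) < 1.
  by split=> //; apply: coprime_prime_abs pq q1.
rewrite lt_neqAle prime_abs_le1 // andbT; apply/eqP => q1.
apply: (abs_series_term_lbound LP (a := 1) (N := 0)) ucv => // n _.
rewrite /S_term (absM LP) (avV LP) !(avX LP) !jP !(completion_isometric iP) q1.
rewrite expr1n mul1r invf_ge1; last first.
  rewrite exprn_gt0 // -(completion_isometric iP) (av_gt0 (vabsP Kl)) // fmorph_eq0.
  by apply: contraNneq p0 => H; apply/eqP/val_inj.
by rewrite exprn_ile1 ?prime_abs_le1 // -(completion_isometric iP) (abs_ge0 (vabsP Kl)).
Qed.

End PrimeConvergence.

Lemma isometric_series_sum (R : realType) (L M : valuedField R)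
    (j : {rmorphism L -> M}) (p q : L) (z : Z2) (y : L) :
  isometric (@vabs R L) j -> abs_series_sum (@vabs R L) (S_term p q z) y ->
  abs_series_sum (@vabs R M) (S_term (j p) (j q) z) (j y).
Proof.
move=> jP; rewrite /abs_series_sum /abs_cvg_to series_rmorph.
by under [X in _ -> X @ _ --> _]eq_fun do rewrite /= -rmorphB jP.
Qed.

Unset Implicit Arguments.

Theorem proposition1 (R : realType) (K : fieldExtType rat)
    (iota : {rmorphism K -> R[i]}) (p q : ringOfIntegers K)
    (p_neq0 : p != 0) (q_neq0 : q != 0)
    (K_gen : (<<1 & [:: OKval p; OKval q]>> = fullv)%VS)
    (pq_coprime : coprime_OK p q) (z : Z2) :
  (~ range Z2_of_nat z ->
   forall (l : primeOf K) (c : R), 0 < c < 1 ->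
   forall (Kl : valuedField R) (K_Kl : {rmorphism K -> Kl}),
     is_completion (prime_abs l c) K_Kl ->
   forall (p0 : nat), prime p0 -> prime_dvd l p0%:R ->
   forall (b : R), 0 < b < 1 ->
   forall (Cl : Cp_data p0 b) (Kl_Cl : {rmorphism Kl -> Cl}),
     isometric (@vabs R Kl) Kl_Cl ->
   let u := S_term (Kl_Cl (K_Kl (OKval p))) (Kl_Cl (K_Kl (OKval q))) z in
   (abs_series_cvg (@vabs R Cl) u <->
      prime_abs l c (OKval p) = 1 /\ prime_abs l c (OKval q) < 1) /\
   (forall s : Cl, abs_series_sum (@vabs R Cl) u s ->
      exists2 y : Kl, valuation_ring Kl y & Kl_Cl y = s))
  /\
  (range Z2_of_nat z ->
   let u := S_term (iota (OKval p)) (iota (OKval q)) z in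
   (abs_series_cvg (@ComplexField.Normc.normc R) u <->
      1 < ComplexField.Normc.normc (iota (OKval p))) /\
   (forall s : R[i], abs_series_sum (@ComplexField.Normc.normc R) u s ->
      exists y : K, iota y = s)).
Proof.
split=> [zN l c c01 Kl i iP p0 _ _ b _ Cl j jP u|[m _ <-{z}] u].
  have nec : abs_series_cvg (@vabs R Cl) u ->
      prime_abs l c (OKval p) = 1 /\ prime_abs l c (OKval q) < 1.
    exact: (S_prime_cvg_cond c01 iP p_neq0 pq_coprime jP).
  (* The sum is found in the complete field [Kl] and carried to [Cl]; uniqueness of limits then puts
     any sum in the image of [Kl]. *)
  have suf : prime_abs l c (OKval p) = 1 /\ prime_abs l c (OKval q) < 1 ->
      exists2 y : Kl, valuation_ring Kl y & abs_series_sum (@vabs R Cl) u (j y).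
    move=> [p1 q1]; have [y yv ys] := S_prime_cvg c01 iP p_neq0 zN p1 q1.
    by exists y => //; exact: isometric_series_sum.
  split; first by split=> // /suf[y _ ys]; exists (j y).
  move=> s us; have [y yv ys] := suf (nec (ex_intro _ s us)).
  by exists y => //; exact: (abs_cvg_unique (vabsP Cl) ys us).
have CP := normc_absolute_value R.
have vp0 : OKval p != 0 by apply: contraNneq p_neq0 => H; apply/eqP/val_inj.
have vq0 : OKval q != 0 by apply: contraNneq q_neq0 => H; apply/eqP/val_inj.
have np0 : 0 < ComplexField.Normc.normc (iota (OKval p)).
  by rewrite (av_gt0 CP) ?fmorph_eq0.
have uE n : (m <= n)%N ->
    u n = iota (OKval q) ^+ popcount m * (iota (OKval p))^-1 ^+ n.
  by move=> mn; rewrite /u /S_term Z2_of_nat_ge // exprVn.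
have nec : abs_series_cvg (@ComplexField.Normc.normc R) u ->
    1 < ComplexField.Normc.normc (iota (OKval p)).
  move=> ucv; rewrite ltNge; apply/negP => p1.
  (* For [|p| <= 1] the factor [|p|^(-n)] is at least 1, so the terms stay above the constant
     [|q|^popcount m], positive since [q] is non-zero. *)
  apply: (abs_series_term_lbound CP
    (a := ComplexField.Normc.normc (iota (OKval q) ^+ popcount m)) (N := m)) ucv.
    by rewrite (av_gt0 CP) ?expf_neq0 ?fmorph_eq0.
  move=> n /uE ->; rewrite (absM CP) (avX CP _ n) (avV CP).
  by rewrite ler_peMr ?(abs_ge0 CP) // exprn_ege1 // invf_ge1.
have suf : 1 < ComplexField.Normc.normc (iota (OKval p)) ->
    exists y : K, abs_series_sum (@ComplexField.Normc.normc R) u (iota y).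
  (* The witness is the closed form of [geometric_series_cvg] with ratio [1 / p], written in [K]
     before [iota] is applied. *)
  move=> p1; exists (series (S_term (OKval p) (OKval q) (Z2_of_nat m)) m
    + OKval q ^+ popcount m * (OKval p)^-1 ^+ m / (1 - (OKval p)^-1)).
  rewrite rmorphD fmorph_div rmorphM rmorphB rmorph1 !rmorphXn fmorphV.
  have -> : iota (series (S_term (OKval p) (OKval q) (Z2_of_nat m)) m) = series u m.
    by rewrite /u series_rmorph.
  by apply: (geometric_series_cvg CP _ uE); rewrite (avV CP) invf_lt1.
split; first by split=> // /suf[y ys]; exists (iota y).
move=> s us; have [y ys] := suf (nec (ex_intro _ s us)).
by exists y; exact: (abs_cvg_unique CP ys us).
Qed.
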